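(* Subdividing an edge can increase the game zero forcing number: there exist a connected graph $G$ with at least one edge and an edge $e$ of $G$ such that the graph $G'$ obtained from $G$ by subdividing $e$ satisfies $Z_g(G')>Z_g(G)$.
   Context: All graphs are finite and simple. Subdividing an edge $e=xy$ means deleting $e$, adding one new vertex $w$, and adding the edges $xw$ and $wy$. The game: Let $G$ be a connected graph with at least one edge; initially all vertices are white. Alice (blue) and Bob (red) alternate turns, Alice first. On each turn the player makes exactly one move: a seed move (colour one white vertex with the player's colour) or a force move $u\to v$ (if a vertex $u$ of the player's colour has exactly one white neighbour $v$, colour $v$ with the player's colour). Being the unique white neighbour is with respect to all white vertices, irrespective of who coloured the others. If a white vertex is the target of one of the player's own legal forces, colouring it counts as a force move and not as a seed move. A move blocks a legal force $u\to v$ if that force is no longer legal after the move. Force Preservation Rule: considering the opponent's legal forces (those the opponent's coloured vertices could make) at the beginning of a turn, (i) a player may always perform one of their own legal forces, even if this blocks a force of the opponent; (ii) a seed move that blocks a legal force of the opponent is permitted only when every available seed move blocks at least one of the opponent's legal forces. The game ends when every vertex is coloured. Optimal play and $Z_g$: For a position $P$ define a set $\mathcal O(P)$ of pairs. If $P$ is terminal and Alice and Bob made $s_A$ and $s_B$ seed moves in total, then $\mathcal O(P)=\{(s_A,s_B)\}$. Otherwise let $\mathcal U(P)=\bigcup_m \mathcal O(P_m)$ over all legal moves $m$, where $P_m$ is the resulting position; $\mathcal O(P)$ is the set of all pairs in $\mathcal U(P)$ with minimum first coordinate if Alice is to move, and with minimum second coordinate if Bob is to move. Let $\mathcal O(G)=\mathcal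 O(P_0(G))$ for the initial position $P_0(G)$. The game zero forcing number is $Z_g(G)=\min\{s_A+s_B:(s_A,s_B)\in\mathcal O(G)\}$. *)

(* Defs.v *)
From mathcomp Require Import all_boot.
Set Implicit Arguments.
Unset Strict Implicit.
Unset Printing Implicit Defensive.

Record sgraph := SGraph {
  vertex :> finType;
  adj : rel vertex;
  adj_sym : symmetric adj;
  adj_irr : irreflexive adj }.

Definition connected_graph (G : sgraph) : Prop :=
  forall x y : G, connect (@adj G) x y.

Section Subdivision.
Variables (G : sgraph) (x y : G).

(* The new vertex is [None]; the old vertices are [Some a]. *)
Definition sub_adj (u v : option G) : bool :=
  match u, v with
  | Some a, Some b =>
      adj a b && ~~ [|| (a == x) && (b == y) | (a == y) && (b == x)]
  | Some a, None | None, Some a => (a == x) || (a == y)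
  | None, None => false
  end.

Lemma sub_adj_sym : symmetric sub_adj.
Proof.
move=> [a|] [b|] //=; rewrite adj_sym; congr (_ && ~~ _).
by rewrite orbC; congr (_ || _); rewrite andbC.
Qed.

Lemma sub_adj_irr : irreflexive sub_adj.
Proof. by move=> [a|] //=; rewrite adj_irr. Qed.

(* Only meaningful when [x] and [y] are adjacent. *)
Definition subdivide : sgraph := SGraph sub_adj_sym sub_adj_irr.

End Subdivision.

Definition player := bool.
Definition alice : player := true.
Definition bob : player := false.
Definition opponent (p : player) : player := ~~ p.

Section Game.
Variable G : sgraph.

(* [None] is white, [Some p] is the colour of player [p]. *)
Definition colouring := {ffun G -> option player}.

Implicit Types (c : colouring) (p : player) (u v w : G).

Definition white c v : bool := c v == None.

Definition colour c p v : colouring :=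
  [ffun z => if z == v then Some p else c z].

Definition legal_force c p u v : bool :=
  [&& c u == Some p, adj u v, white c v
    & [forall w, adj u w && white c w ==> (w == v)]].

(* A white vertex that [p] can force is not available as a seed for [p]. *)
Definition available_seed c p v : bool :=
  white c v && ~~ [exists u, legal_force c p u v].

Definition blocking c p v : bool :=
  [exists u, exists w, legal_force c (opponent p) u w
    && ~~ legal_force (colour c p v) (opponent p) u w].

(* Force Preservation Rule (ii); rule (i) leaves forces unrestricted. *)
Definition legal_seed c p v : bool :=
  available_seed c p v &&
  (blocking c p v ==> [forall w, available_seed c p w ==> blocking c p w]).

Record position := Position {
  pcol : colouring;
  to_move : player;
  seedsA : nat;
  seedsB : nat }.

(* [inl v]: seed move at [v]; [inr (u, v)]: force move [u -> v]. *)
Definition move := (G + G * G)%type.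

Definition legal_move (P : position) (m : move) : bool :=
  match m with
  | inl v => legal_seed (pcol P) (to_move P) v
  | inr (u, v) => legal_force (pcol P) (to_move P) u v
  end.

Definition play (P : position) (m : move) : position :=
  let p := to_move P in
  match m with
  | inl v => Position (colour (pcol P) p v) (opponent p)
               (seedsA P + (p == alice)) (seedsB P + (p == bob))
  | inr (_, v) => Position (colour (pcol P) p v) (opponent p)
                    (seedsA P) (seedsB P)
  end.

Definition terminal (P : position) : bool := [forall v, ~~ white (pcol P) v].

Definition score (p : player) (o : nat * nat) : nat :=
  if p == alice then o.1 else o.2.

Definition optimal_for p (U : seq (nat * nat)) : seq (nat * nat) :=
  [seq o <- U | all (fun q => score p o <= score p q) U].

(* Finite sets of pairs are represented by sequences. [k] is fuel: every move
   colours exactly one vertex, so the number of white vertices suffices and the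
   [[::]] branch is not reached from [outcomes]. *)
Fixpoint outcomes_rec (k : nat) (P : position) : seq (nat * nat) :=
  if terminal P then [:: (seedsA P, seedsB P)] else
  if k is k'.+1 then
    optimal_for (to_move P)
      (undup (flatten [seq outcomes_rec k' (play P m)
                      | m <- enum (legal_move P)]))
  else [::].

Definition outcomes (P : position) : seq (nat * nat) :=
  outcomes_rec #|[set v | white (pcol P) v]| P.

Definition initial : position := Position [ffun => None] alice 0 0.

End Game.

(* The default [head 0 s] only matters for the empty sequence. *)
Definition seq_min (s : seq nat) : nat := foldr minn (head 0 s) s.

Definition Zg (G : sgraph) : nat :=
  seq_min [seq o.1 + o.2 | o <- outcomes (initial G)].

(* Main.v *)
(* The graph is the paw (a triangle with a pendant edge), and the subdivided
   edge is the pendant one: Zg is 2 before the subdivision and 3 after it. Both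
   game trees are small enough to be evaluated. *)
Require Import Defs.
From mathcomp Require Import all_boot.
Set Implicit Arguments.
Unset Strict Implicit.
Unset Printing Implicit Defensive.

(** Both premises depend only on the set of entries, so the minimum can be read off any other list
    with the same members. *)
Lemma seq_minP (t : seq nat) n :
  n \in t -> all (leq n) t -> seq_min t = n.
Proof.
rewrite /seq_min => nt /allP le_nt.
have fold_le d (r : seq nat) m : m \in r -> foldr minn d r <= m.
  elim: r => //= x r IHr; rewrite inE geq_min => /predU1P[-> | /IHr ->].
    by rewrite leqnn.
  exact: orbT.
apply/eqP; rewrite eqn_leq fold_le //=.
(* The fold starts from the head, so this value must be bounded too. It is an entry of [t], since
   [n \in t] rules out the empty list and its default 0. *)
have: n <= head 0 t by case: (t) nt le_nt => //= x r _; apply; apply: mem_head.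
elim: (t) (head 0 t) le_nt => //= x r IHr d le_nr nd.
rewrite leq_min le_nr ?mem_head // IHr // => y yr.
by apply: le_nr; rewrite inE yr orbT.
Qed.

(* The definitions of the game quantify over a finType and store colourings as
   finite functions, which does not reduce; here they are transcribed with an
   explicit list [s] of the vertices and colourings as plain functions. *)
Section Evaluation.
Variables (G : sgraph) (s : seq G).
Hypothesis s_full : forall v, v \in s.

Implicit Types (c : colouring G) (f : G -> option player) (p : player).
Implicit Types (u v w : G).

Lemma forall_all (P : pred G) : [forall v, P v] = all P s.
Proof. by apply/forallP/allP => [h v _ | h v]; apply: h. Qed.

Lemma exists_has (P : pred G) : [exists v, P v] = has P s.
Proof.
by apply/existsP/hasP => [[v Pv] | [v _ Pv]]; exists v.
Qed.

Definition ev_white f v : bool := if f v is None then true else false.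

Definition ev_colour f p v : G -> option player :=
  fun z => if z == v then Some p else f z.

Definition ev_force f p u v : bool :=
  if f u is Some q then
    [&& q == p, adj u v, ev_white f v
      & all (fun w => adj u w && ev_white f w ==> (w == v)) s]
  else false.

Definition ev_available f p v : bool :=
  ev_white f v && ~~ has (fun u => ev_force f p u v) s.

Definition ev_blocking f p v : bool :=
  has (fun u => has (fun w => ev_force f (opponent p) u w
    && ~~ ev_force (ev_colour f p v) (opponent p) u w) s) s.

Definition ev_seed f p v : bool :=
  ev_available f p v &&
  (ev_blocking f p v ==>
     all (fun w => ev_available f p w ==> ev_blocking f p w) s).

(** Moves are indexed by the vertex they colour: forces onto the same target lead to the same
    position, so one branch per forceable vertex is enough. The tallies [a] and [b] stand for
    [seedsA] and [seedsB]. *)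
Fixpoint ev_outcomes k f p a b : seq (nat * nat) :=
  if all (fun v => ~~ ev_white f v) s then [:: (a, b)] else
  if k is k'.+1 then
    optimal_for p
      (flatten [seq ev_outcomes k' (ev_colour f p v) (opponent p)
                      (a + (p == alice)) (b + (p == bob))
               | v <- s & ev_seed f p v] ++
       flatten [seq ev_outcomes k' (ev_colour f p v) (opponent p) a b
               | v <- s & has (fun u => ev_force f p u v) s])
  else [::].

Lemma whiteE c f v : c =1 f -> white c v = ev_white f v.
Proof. by rewrite /white /ev_white => ->; case: (f v). Qed.

Lemma colourE c f p v : c =1 f -> colour c p v =1 ev_colour f p v.
Proof. by move=> cf z; rewrite ffunE /ev_colour cf. Qed.

Lemma legal_forceE c f p u v :
  c =1 f -> legal_force c p u v = ev_force f p u v.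
Proof.
move=> cf; rewrite /legal_force /ev_force cf forall_all (whiteE _ cf).
case: (f u) => // q; congr [&& _, _, _ & _].
by apply: eq_all => w; rewrite (whiteE _ cf).
Qed.

Lemma forceableE c f p v :
  c =1 f -> [exists u, legal_force c p u v] = has (fun u => ev_force f p u v) s.
Proof.
by move=> cf; rewrite exists_has; apply: eq_has => u; rewrite (legal_forceE _ _ _ cf).
Qed.

Lemma available_seedE c f p v :
  c =1 f -> available_seed c p v = ev_available f p v.
Proof.
by move=> cf; rewrite /available_seed (whiteE _ cf) (forceableE _ _ cf).
Qed.

Lemma blockingE c f p v : c =1 f -> blocking c p v = ev_blocking f p v.
Proof.
move=> cf; rewrite /blocking exists_has; apply: eq_has => u.
rewrite exists_has; apply: eq_has => w.
by rewrite (legal_forceE _ _ _ cf) (legal_forceE _ _ _ (colourE p v cf)).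
Qed.

Lemma legal_seedE c f p v : c =1 f -> legal_seed c p v = ev_seed f p v.
Proof.
move=> cf; rewrite /legal_seed (available_seedE _ _ cf) (blockingE _ _ cf).
rewrite forall_all; congr (_ && (_ ==> _)); apply: eq_all => w.
by rewrite (available_seedE _ _ cf) (blockingE _ _ cf).
Qed.

(** Optimality compares an outcome with all members of the list, regardless of order and repetition;
    this carries set equality up each level of the game tree. *)
Lemma eq_optimal_for p (U V : seq (nat * nat)) :
  U =i V -> optimal_for p U =i optimal_for p V.
Proof.
by move=> UV o; rewrite !mem_filter UV (eq_all_r UV).
Qed.

(** The two sides list moves in different orders and repeat outcomes differently, hence equality as
    sets only. The induction on the fuel leaves [c] and [f] general, because each move recolours
    both. *)
Lemma outcomes_recE k c f p a b :
  c =1 f -> outcomes_rec k (Position c p a b) =i ev_outcomes k f p a b.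
Proof.
elim: k c f p a b => [|k IHk] c f p a b cf /=;
  have -> : terminal (Position c p a b) = all (fun v => ~~ ev_white f v) s
    by rewrite /terminal forall_all; apply: eq_all => v; rewrite (whiteE _ cf).
  by [].
case: ifP => // _; apply: eq_optimal_for => o; rewrite mem_undup mem_cat.
apply/flatten_mapP/orP => [[[v|[u v]]]|].
- rewrite mem_enum unfold_in /= (legal_seedE _ _ cf) => lv ov; left.
  apply/flatten_mapP; exists v; first by rewrite mem_filter lv s_full.
  by rewrite -(IHk _ _ _ _ _ (colourE p v cf)).
(* The source [u] of the force is forgotten here; the converse recovers some source from [has]. *)
- rewrite mem_enum unfold_in /= (legal_forceE _ _ _ cf) => lu ov; right.
  apply/flatten_mapP; exists v; last by rewrite -(IHk _ _ _ _ _ (colourE p v cf)).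
  by rewrite mem_filter s_full andbT; apply/hasP; exists u.
- case=> /flatten_mapP[v]; rewrite mem_filter => /andP[lv _];
    rewrite -(IHk _ _ _ _ _ (colourE p v cf)) => ov.
    by exists (inl v); rewrite ?mem_enum ?unfold_in /= ?(legal_seedE _ _ cf).
  case/hasP: lv => u _ lu; exists (inr (u, v)) => //.
  by rewrite mem_enum unfold_in /= (legal_forceE _ _ _ cf).
Qed.

(** For a concrete graph the premise is a boolean that can be decided by running the game tree. *)
Lemma Zg_eval n :
  let t := [seq o.1 + o.2 | o <- ev_outcomes #|G| (fun=> None) alice 0 0] in
  (n \in t) && all (leq n) t -> Zg G = n.
Proof.
move=> t /andP[nt le_nt].
have -> : Zg G = seq_min [seq o.1 + o.2 | o <- outcomes (initial G)] by [].
have outE : outcomes (initial G) =i ev_outcomes #|G| (fun=> None) alice 0 0.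
  move=> o; rewrite /outcomes.
  (* Every vertex is white at the start, so the initial fuel is the order of the graph. *)
  have -> : #|[set v | white (pcol (initial G)) v]| = #|G|.
    by rewrite -cardsT; apply: eq_card => v; rewrite !inE /white ffunE.
  by apply: outcomes_recE => v; rewrite ffunE.
have mapE := eq_mem_map (fun o : nat * nat => o.1 + o.2) outE.
by apply: seq_minP; [rewrite mapE | rewrite (eq_all_r mapE)].
Qed.

End Evaluation.

(* Triangle on [(false, false)], [(false, true)], [(true, false)], with
   [(true, true)] pendant at [(false, false)]. *)
Definition paw_adj (u v : bool * bool) : bool :=
  (u != v) && [|| u == (false, false), v == (false, false)
                | (u != (true, true)) && (v != (true, true))].

Lemma paw_adj_sym : symmetric paw_adj.
Proof. by move=> [[] []] [[] []]. Qed.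

Lemma paw_adj_irr : irreflexive paw_adj.
Proof. by move=> [[] []]. Qed.

Definition paw : sgraph := SGraph paw_adj_sym paw_adj_irr.

Definition paw_vertices : seq paw :=
  [:: (false, false); (false, true); (true, false); (true, true)].

Lemma mem_paw_vertices v : v \in paw_vertices.
Proof. by case: v => [[] []]. Qed.

Lemma paw_connected : connected_graph paw.
Proof.
move=> u v; apply: (@connect_trans _ _ ((false, false) : paw)).
  by case: u => [[] []]; rewrite ?connect0 // connect1.
by case: v => [[] []]; rewrite ?connect0 // connect1.
Qed.

Lemma Zg_paw : Zg paw = 2.
Proof.
apply: (Zg_eval mem_paw_vertices).
(* Cardinality is locked, so the fuel must be rewritten into numerals before the evaluation can
   run. *)
by rewrite card_prod card_bool; vm_compute.
Qed.

Definition subdivided_paw : sgraph :=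
  @subdivide paw (false, false) (true, true).

Definition subdivided_paw_vertices : seq subdivided_paw :=
  None :: [seq Some v | v <- paw_vertices].

Lemma mem_subdivided_paw_vertices v : v \in subdivided_paw_vertices.
Proof. by case: v => [[[] []]|]. Qed.

Lemma Zg_subdivided_paw : Zg subdivided_paw = 3.
Proof.
apply: (Zg_eval mem_subdivided_paw_vertices).
by rewrite card_option card_prod card_bool; vm_compute.
Qed.

Theorem proposition25 :
  exists (G : sgraph) (x y : G),
    [/\ connected_graph G, adj x y & Zg G < Zg (subdivide x y)].
Proof.
exists paw, (false, false), (true, true); split=> //; first exact: paw_connected.
by rewrite Zg_paw [Zg _]Zg_subdivided_paw.
Qed.
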